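(* Let $\gamma,\kappa>0$, let $A:\mathbb{R}^n\to\mathbb{R}$ be a $\gamma$-function and $V:\mathbb{R}^n\to\mathbb{R}$ a $\kappa$-function, let $q>0$ be such that $q+V(x)+A(\xi)\ge 1$ for all $x,\xi\in\mathbb{R}^n$, and let $g=g^{(A,V)}$ be the associated metric. Then for every $m\in\mathbb{R}$ $$\Sigma^m_{A,V}=S\Big(\lambda_g^{\,m\left(\frac{2\kappa\gamma}{\kappa+\gamma}\right)},g\Big).$$
   Context: $\tau$-functions: a continuous function $\Gamma:\mathbb{R}^n\to\mathbb{R}$ is a $\tau$-function ($\tau>0$) if there is $q_0>0$ such that (a) $\Gamma(x)+\frac{q_0}{4}>0$ for all $x\in\mathbb{R}^n$; and (b) there are $C_1>0$, $R>0$ with $C_1\big|(\frac{q_0}{2}+\Gamma(x))^{\frac1{2\tau}}-(\frac{q_0}{2}+\Gamma(y))^{\frac1{2\tau}}\big|\le |x-y|$ for all $|x|,|y|\ge R$. Metric: for $X=(x,\xi)$, $T=(t,\tau)\in\mathbb{R}^n\times\mathbb{R}^n$, $$g_X(T)=g^{(A,V)}_X(T)=\frac{|t|^2}{(q+V(x)+A(\xi))^{1/\kappa}}+\frac{|\tau|^2}{(q+V(x)+A(\xi))^{1/\gamma}} .$$ Uncertainty parameter: $\lambda_g(X)=\inf_{T\ne0}\left(\frac{g_X^\sigma(T)}{g_X(T)}\right)^{1/2}$, where $g_X^\sigma(T)=\sup_{Y\neq0}\frac{\sigma(Y,T)^2}{g_X(Y)}$ and $\sigma(Y,T)=t\cdot\eta-y\cdot\tau$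 for $Y=(y,\eta)$, $T=(t,\tau)$. Symbol classes: for a positive function $M$ on $\mathbb{R}^n\times\mathbb{R}^n$, $S(M,g)$ is the set of smooth functions $a$ on $\mathbb{R}^n\times\mathbb{R}^n$ such that for every integer $k\ge0$ there is $C_k>0$ with $|a^{(k)}(X;T_1,\dots,T_k)|\le C_kM(X)\prod_{i=1}^k g_X^{1/2}(T_i)$ for all $X,T_1,\dots,T_k$, where $a^{(k)}(X;T_1,\dots,T_k)$ is the $k$-th derivative of $a$ at $X$ in the directions $T_1,\dots,T_k$. $\Sigma^m_{A,V}$ is the set of $a\in C^\infty(\mathbb{R}^n\times\mathbb{R}^n)$ such that, for the constant $q$ chosen above, for all multi-indices $\alpha,\beta$ there is $C_{\alpha\beta}$ with $|\partial_x^\beta\partial_\xi^\alpha a(x,\xi)|\le C_{\alpha\beta}(q+V(x)+A(\xi))^{m-\frac{|\beta|}{2\kappa}-\frac{|\alpha|}{2\gamma}}$ for all $x,\xi\in\mathbb{R}^n$. *)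

(* Defs.v *)
From HB Require Import structures.
From mathcomp Require Import all_boot all_order all_algebra.
From mathcomp Require Import all_classical all_reals all_analysis.
From mathcomp Require Import complex.

Set Implicit Arguments.
Unset Strict Implicit.
Unset Printing Implicit Defensive.

Import Order.TTheory GRing.Theory Num.Theory.
Import numFieldNormedType.Exports.
Import ComplexField.Normc.

Local Open Scope classical_set_scope.
Local Open Scope ring_scope.

Definition dot (R : realType) (n : nat) (x y : 'rV[R]_n) : R :=
  \sum_(i < n) x 0 i * y 0 i.

(* The norm carried by ['rV[R]_n] in the library is the sup norm; [|x|] in the
   estimates below is the Euclidean one. *)
Definition enorm (R : realType) (n : nat) (x : 'rV[R]_n) : R :=
  Num.sqrt (dot x x).

Definition tau_function (R : realType) (n : nat) (tau : R)
    (G : 'rV[R]_n -> R) : Prop :=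
  continuous G /\
  exists q0 : R, [/\ 0 < q0,
    forall x, 0 < G x + q0 / 4 &
    exists C1 r : R, [/\ 0 < C1, 0 < r &
      forall x y, r <= enorm x -> r <= enorm y ->
        C1 * `|(q0 / 2 + G x) `^ (1 / (2 * tau))
               - (q0 / 2 + G y) `^ (1 / (2 * tau))| <= enorm (x - y)]].

Section PhaseSpace.
Context {R : realType} {n : nat}.
Local Notation phase := ('rV[R]_n * 'rV[R]_n)%type.

Definition weight (q : R) (A V : 'rV[R]_n -> R) (X : phase) : R :=
  q + V X.1 + A X.2.

Definition metric (gamma kappa q : R) (A V : 'rV[R]_n -> R)
    (X T : phase) : R :=
  enorm T.1 ^+ 2 / weight q A V X `^ (1 / kappa)
  + enorm T.2 ^+ 2 / weight q A V X `^ (1 / gamma).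

Definition symplectic (Y T : phase) : R := dot T.1 Y.2 - dot Y.1 T.2.

(* For n > 0 and each [g X] a positive definite quadratic form, the sets below
   are nonempty and respectively bounded above and below, so that the
   real-valued [sup] and [inf] are the genuine ones. *)
Definition dual_metric (g : phase -> phase -> R) (X T : phase) : R :=
  sup [set symplectic Y T ^+ 2 / g X Y | Y in [set Y : phase | Y != 0]].

Definition uncertainty (g : phase -> phase -> R) (X : phase) : R :=
  inf [set Num.sqrt (dual_metric g X T / g X T) |
        T in [set T : phase | T != 0]].

(* [iter_deriv [:: T1; ...; Tk] f X] is the k-th derivative of f at X in the
   directions T1, ..., Tk. *)
Definition iter_deriv (s : seq phase) (f : phase -> R) : phase -> R :=
  foldr (fun (T : phase) (h : phase -> R) => 'D_T h) f s.

Definition smooth (f : phase -> R) : Prop :=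
  forall (s : seq phase) (X : phase), differentiable (iter_deriv s f) X.

(* Symbols are complex valued; [R[i]] is not a normed module over [R] in the
   library, so differentiation is done on real and imaginary parts. *)
Definition csmooth (a : phase -> R[i]) : Prop :=
  smooth (fun X => complex.Re (a X)) /\ smooth (fun X => complex.Im (a X)).

Definition citer_deriv (s : seq phase) (a : phase -> R[i]) (X : phase) : R[i] :=
  (iter_deriv s (fun Y => complex.Re (a Y)) X
   +i* iter_deriv s (fun Y => complex.Im (a Y)) X)%C.

Definition symbol_class (M : phase -> R) (g : phase -> phase -> R) :
    set (phase -> R[i]) :=
  [set a | csmooth a /\
    forall k : nat, exists2 C : R, 0 < C &
      forall (X : phase) (T : k.-tuple phase),
        normc (citer_deriv T a X)
        <= C * M X * \prod_(i < k) Num.sqrt (g X (tnth T i))].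

Definition multi_index := {ffun 'I_n -> nat}.

Definition mi_size (alpha : multi_index) : nat := (\sum_(i < n) alpha i)%N.

Definition mi_dirs (e : 'I_n -> phase) (alpha : multi_index) : seq phase :=
  flatten [seq nseq (alpha i) (e i) | i <- enum 'I_n].

Definition e_x (i : 'I_n) : phase := (delta_mx 0 i, 0).
Definition e_xi (i : 'I_n) : phase := (0, delta_mx 0 i).

(* d_x^beta d_xi^alpha a *)
Definition partial (beta alpha : multi_index) (a : phase -> R[i]) :
    phase -> R[i] :=
  citer_deriv (mi_dirs e_x beta ++ mi_dirs e_xi alpha) a.

Definition Sigma_class (gamma kappa q : R) (A V : 'rV[R]_n -> R) (m : R) :
    set (phase -> R[i]) :=
  [set a | csmooth a /\
    forall alpha beta : multi_index, exists C : R,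
      forall X : phase,
        normc (partial beta alpha a X)
        <= C * weight q A V X
             `^ (m - (mi_size beta)%:R / (2 * kappa)
                   - (mi_size alpha)%:R / (2 * gamma))].

End PhaseSpace.

(* Main.v *)
(* With w = q + V(x) + A(xi), the metric is |t|^2 / a + |tau|^2 / b where
   a = w^(1/kappa) and b = w^(1/gamma), and its symplectic dual is exactly
   b |t|^2 + a |tau|^2 = a b g, so that lambda_g = sqrt (a b) and the order
   function of the symbol class is w^m. The two families of estimates then
   differ only in the directions of differentiation: coordinate vectors e have
   sqrt g(e) equal to w^(-1/(2 kappa)) or w^(-1/(2 gamma)), and conversely each
   coordinate c of T satisfies |c| sqrt g(e) <= sqrt g(T), so expanding the
   k-th derivative multilinearly, and reordering the coordinate directions by
   the symmetry of second derivatives, bounds it by the partial derivatives. *)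
Require Import Defs.
From mathcomp Require Import all_boot all_order all_algebra.
From mathcomp Require Import all_classical all_reals all_analysis.
From mathcomp Require Import complex.
From mathcomp Require Import ring.

Import Order.TTheory GRing.Theory Num.Theory.
Import numFieldNormedType.Exports.
Import ComplexField.Normc.

Local Open Scope classical_set_scope.
Local Open Scope ring_scope.

(** * Symmetry of second directional derivatives *)

Section MixedDerivatives.
Context {R : realType} {V : normedModType R}.
Implicit Types (f : V -> R) (x u v : V).

Lemma is_derive_along_line f x u (t : R) : derivable f (x + t *: u) u ->
  is_derive t 1 (fun s : R => f (x + s *: u)) ('D_u f (x + t *: u)).
Proof.
move=> df.
have quotE : (fun h : R => h^-1 *: (((fun s : R => f (x + s *: u)) \o shift t)
    (h *: 1) - f (x + t *: u))) =
  (fun h : R => h^-1 *: ((f \o shift (x + t *: u)) (h *: u) - f (x + t *: u))).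
  apply/funext => h /=; rewrite /shift /= -[h *: 1]/(h * 1) mulr1.
  by rewrite scalerDl addrCA.
apply: DeriveDef; first by rewrite /derivable quotE.
by rewrite /derive quotE.
Qed.

Lemma directional_MVT f x u (h : R) : 0 < h ->
  (forall y, derivable f y u) ->
  exists2 p : R, 0 < p < h & f (x + h *: u) - f x = 'D_u f (x + p *: u) * h.
Proof.
move=> h0 df.
pose F s := f (x + s *: u).
have dF (t : R) : is_derive t 1 F ('D_u f (x + t *: u)).
  exact/is_derive_along_line/df.
have [|p pI E] :=
  @MVT R F (fun t => 'D_u f (x + t *: u)) 0 h h0 (fun t _ => dF t).
  apply: continuous_subspaceT => t.
  by apply: differentiable_continuous; apply/derivable1_diffP; case: (dF t).
exists p; first by move: pI; rewrite in_itv.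
by move: E; rewrite /F subr0 scale0r addr0.
Qed.

(** Mean value theorem along [u] for [y |-> f (y + h *: v) - f y], then along [v] for ['D_u f]. The
    left side is symmetric in [u] and [v], so it can be computed in either order. *)
Lemma second_difference f x u v (h : R) : 0 < h ->
  (forall y, derivable f y u) -> (forall y, derivable ('D_u f) y v) ->
  exists p q : R, [/\ 0 < p < h, 0 < q < h &
    f (x + h *: u + h *: v) - f (x + h *: u) - f (x + h *: v) + f x =
    'D_v ('D_u f) (x + p *: u + q *: v) * h * h].
Proof.
move=> h0 df ddf.
pose F y := f (y + h *: v) - f y.
have dF y : is_derive y u F ('D_u f (y + h *: v) - 'D_u f y).
  have dshift : is_derive y u (fun z => f (z + h *: v)) ('D_u f (y + h *: v)).
    have quotE : (fun k : R => k^-1 *: (((fun z => f (z + h *: v)) \o shift y)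
        (k *: u) - f (y + h *: v))) =
      (fun k : R => k^-1 *: ((f \o shift (y + h *: v)) (k *: u)
        - f (y + h *: v))).
      by apply/funext => k; rewrite /= /shift /= addrA.
    apply: DeriveDef; first by rewrite /derivable quotE; exact: df.
    by rewrite /derive quotE.
  apply: is_deriveB; exact: DeriveDef.
have [y|p pI Ep] := @directional_MVT F x u h h0; first by case: (dF y).
have [q qI Eq] := @directional_MVT ('D_u f) (x + p *: u) v h h0 ddf.
exists p, q; split=> //.
move: Ep; rewrite (@derive_val _ _ _ _ _ _ _ (dF _)) Eq => <-.
rewrite /F; ring.
Qed.

(** Both mixed derivatives, taken at suitable points near [x], equal the same second difference
    divided by [h ^+ 2]. Continuity at [x] carries the equality to [x], up to an arbitrary [e]. *)
Lemma derive_comm f x u v :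
  (forall y, derivable f y u) -> (forall y, derivable f y v) ->
  (forall y, derivable ('D_u f) y v) -> (forall y, derivable ('D_v f) y u) ->
  {for x, continuous ('D_v ('D_u f))} -> {for x, continuous ('D_u ('D_v f))} ->
  'D_u ('D_v f) x = 'D_v ('D_u f) x.
Proof.
move=> dfu dfv dfuv dfvu cuv cvu.
apply/eqP; rewrite -subr_eq0 -normr_eq0 eq_le normr_ge0 andbT.
apply/ler_addgt0Pl => e e0; rewrite addr0.
have e20 : 0 < e / 2 by rewrite divr_gt0.
have [d1 /= d10 B1] := (nbhs_normP _ _).1 ((cvgrPdist_lt _ _).1 cuv _ e20).
have [d2 /= d20 B2] := (nbhs_normP _ _).1 ((cvgrPdist_lt _ _).1 cvu _ e20).
(* With [h * N = Num.min d1 d2], a displacement [p *: u + q *: v] with [p, q < h] stays within both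
   radii; the added 1 keeps [N] positive when [u] and [v] vanish. *)
pose N := `|u| + `|v| + 1.
have N0 : 0 < N by rewrite /N ltr_wpDl ?addr_ge0.
pose h := Num.min d1 d2 / N.
have h0 : 0 < h by rewrite divr_gt0 // lt_min d10 d20.
have near_x (p q : R) : 0 < p < h -> 0 < q < h ->
    `|x - (x + p *: u + q *: v)| < Num.min d1 d2.
  move=> /andP[p0 ph] /andP[q0 qh].
  rewrite -addrA opprD addrA subrr add0r normrN.
  apply: (le_lt_trans (ler_normD _ _)).
  rewrite !normrZ !gtr0_norm //.
  have -> : Num.min d1 d2 = h * N by rewrite /h divfK // gt_eqF.
  rewrite /N 2!mulrDr mulr1 ltr_pwDr //.
  by rewrite lerD // ler_wpM2r // ltW.
have [p [q [pI qI E1]]] := second_difference f x _ _ _ h0 dfu dfuv.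
have [p' [q' [pI' qI' E2]]] := second_difference f x _ _ _ h0 dfv dfvu.
have hh : h != 0 by rewrite gt_eqF.
have E : 'D_v ('D_u f) (x + p *: u + q *: v) =
         'D_u ('D_v f) (x + p' *: v + q' *: u).
  have swap (a b c d : R) : a - c - b + d = a - b - c + d by ring.
  move: E2; rewrite (addrAC x (h *: v)) swap E1 => E2.
  exact: (mulIf hh (mulIf hh E2)).
have := near_x _ _ pI qI; rewrite lt_min => /andP[/B1 /= b1 _].
have := near_x _ _ qI' pI'; rewrite (addrAC x) lt_min => /andP[_ /B2 /= b2].
rewrite E in b1.
have triangle (a c m r : R) : `|a - m| < r / 2 -> `|c - m| < r / 2 ->
    `|c - a| <= r.
  rewrite (distrC a) => am cm; apply: (le_trans (ler_distD m c a)).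
  by rewrite (splitr r); exact: ltW (ltrD cm am).
exact: (triangle _ _ _ _ b1 b2).
Qed.

End MixedDerivatives.

(** * Reordering and multilinear expansion of iterated derivatives *)

Section IteratedDerivatives.
Context {R : realType} {n : nat}.
Local Notation phase := ('rV[R]_n * 'rV[R]_n)%type.
Implicit Types (f : phase -> R) (s t : seq phase) (T X : phase).

Lemma iter_deriv_cat s t f :
  iter_deriv (s ++ t) f = iter_deriv s (iter_deriv t f).
Proof. exact: foldr_cat. Qed.

Lemma smooth_iter_deriv s f : smooth f -> smooth (iter_deriv s f).
Proof. by move=> sf t X; rewrite -iter_deriv_cat; exact: sf. Qed.

Lemma smooth_derivable f X T : smooth f -> derivable f X T.
Proof. move=> sf; exact/diff_derivable/(sf [::]). Qed.

Lemma smooth_continuous f : smooth f -> continuous f.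
Proof. by move=> sf X; apply: differentiable_continuous; exact: (sf [::]). Qed.

Lemma smooth_derive_comm f S T : smooth f -> 'D_S ('D_T f) = 'D_T ('D_S f).
Proof.
move=> sf; apply/funext => X.
have sD U := smooth_iter_deriv [:: U] f sf.
have sDD U W := smooth_iter_deriv [:: U; W] f sf.
apply: derive_comm => [Y|Y|Y|Y||].
- exact: smooth_derivable.
- exact: smooth_derivable.
- exact: smooth_derivable (sD S).
- exact: smooth_derivable (sD T).
- exact: smooth_continuous (sDD T S) X.
- exact: smooth_continuous (sDD S T) X.
Qed.

Lemma iter_deriv_catCons f s t T : smooth f ->
  iter_deriv (s ++ T :: t) f = iter_deriv (T :: s ++ t) f.
Proof.
move=> sf; elim: s => //= S s ->.
exact: (smooth_derive_comm _ S T (smooth_iter_deriv (s ++ t) f sf)).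
Qed.

(** Induction on [s]: its head occurs somewhere in [t] and can be moved to the front by commuting
    derivatives. *)
Lemma iter_deriv_perm f s t : smooth f -> perm_eq s t ->
  iter_deriv s f = iter_deriv t f.
Proof.
move=> sf; elim: s t => [|T s IH] t.
  by move/perm_size; case: t.
move=> st; have Tt : T \in t by rewrite -(perm_mem st) mem_head.
case/splitPr: Tt st => t1 t2 st.
rewrite iter_deriv_catCons //= (IH (t1 ++ t2)) //.
by rewrite -(perm_cons T) (perm_trans st) // perm_catC /= perm_cons perm_catC.
Qed.

Definition basis_vector (i : 'I_n + 'I_n) : phase :=
  match i with inl j => e_x j | inr j => e_xi j end.

Definition coordinate (i : 'I_n + 'I_n) T : R :=
  match i with inl j => T.1 0 j | inr j => T.2 0 j end.

Lemma coordinate_sum T :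
  T = \sum_(i : 'I_n + 'I_n) coordinate i T *: basis_vector i.
Proof.
have scaleE (c : R) (u v : 'rV[R]_n) : c *: (u, v) = (c *: u, c *: v) by [].
rewrite big_sumType /=; case: T => x xi /=.
rewrite /e_x /e_xi.
under eq_bigr do rewrite scaleE scaler0.
under [X in _ + X]eq_bigr do rewrite scaleE scaler0.
have addl (u v : 'rV[R]_n) : (u + v, 0 : 'rV[R]_n) = (u, 0) + (v, 0) :> phase.
  by rewrite [RHS]/GRing.add /= /add_pair /= addr0.
have addr (u v : 'rV[R]_n) : (0 : 'rV[R]_n, u + v) = (0, u) + (0, v) :> phase.
  by rewrite [RHS]/GRing.add /= /add_pair /= addr0.
rewrite -(big_morph (fun u : 'rV[R]_n => (u, 0) : phase) addl erefl).
rewrite -(big_morph (fun u : 'rV[R]_n => (0, u) : phase) addr erefl).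
rewrite -!row_sum_delta.
by rewrite [RHS]/GRing.add /= /add_pair /= addr0 add0r.
Qed.

Lemma derive_coordinates f X T : differentiable f X ->
  'D_T f X =
  \sum_(i : 'I_n + 'I_n) coordinate i T * 'D_(basis_vector i) f X.
Proof.
move=> df; rewrite deriveE // {1}(coordinate_sum T) linear_sum.
by apply: eq_bigr => i _; rewrite linearZ deriveE.
Qed.

(** Induction on [k] for all [f] and [M] at once: the outermost direction [T] is expanded in the
    basis, each basis derivative is commuted inside onto [f], and its factor
    [Num.sqrt (g X (basis_vector i))] is absorbed into [M]. The coordinate hypothesis then trades
    that factor for [Num.sqrt (g X T)]. *)
Lemma iter_deriv_bound (g : phase -> phase -> R) (M : phase -> R) f k :
  (forall i X T, `|coordinate i T| * Num.sqrt (g X (basis_vector i))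
                 <= Num.sqrt (g X T)) ->
  (forall X, 0 <= M X) -> smooth f ->
  (forall b : seq ('I_n + 'I_n), exists C : R, forall X,
     `|iter_deriv (map basis_vector b) f X|
     <= C * M X * \prod_(i <- b) Num.sqrt (g X (basis_vector i))) ->
  exists2 C : R, 0 < C & forall X s, size s = k ->
    `|iter_deriv s f X| <= C * M X * \prod_(T <- s) Num.sqrt (g X T).
Proof.
move=> coord_le; elim: k f M => [|k IH] f M M0 sf bf.
  have [C HC] := bf [::]; exists (`|C| + 1); first by rewrite ltr_wpDl.
  move=> X s /size0nil ->; apply: (le_trans (HC X)).
  rewrite !big_nil !mulr1 ler_wpM2r //.
  by rewrite (le_trans (ler_norm C)) // lerDl.
have /choice[C HC] : forall i : 'I_n + 'I_n, exists C : R, 0 < C /\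
    forall X s, size s = k ->
    `|iter_deriv s ('D_(basis_vector i) f) X|
    <= C * (M X * Num.sqrt (g X (basis_vector i)))
         * \prod_(T <- s) Num.sqrt (g X T).
  move=> i.
  have [||b|C C0 HC] := IH ('D_(basis_vector i) f)
    (fun X => M X * Num.sqrt (g X (basis_vector i))).
  - by move=> X; rewrite mulr_ge0.
  - exact: (smooth_iter_deriv [:: basis_vector i]).
  (* The new derivative acts first, hence stands last in the list. *)
  - have [C HC] := bf (rcons b i); exists C => X.
    have := HC X; rewrite map_rcons -cats1 iter_deriv_cat /= => /le_trans; apply.
    by rewrite -cats1 big_cat big_seq1 /= -!mulrA [X in M _ * X]mulrC.
  - by exists C.
(* The summand 1 keeps the constant positive even when there are no coordinates. *)
exists (1 + \sum_i C i).
  by rewrite ltr_pwDl // sumr_ge0 // => i _; rewrite ltW //; case: (HC i).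
move=> X [//|T s] /= [sk].
rewrite derive_coordinates; last exact: sf.
apply: (le_trans (ler_norm_sum _ _ _)).
set P := \prod_(T <- _) _.
apply: (@le_trans _ _ (\sum_i C i * M X * P)); last first.
  rewrite -!mulr_suml -mulrA -[X in _ <= X]mulrA ler_wpM2r ?lerDr //.
  by rewrite mulr_ge0 // prodr_ge0.
apply: ler_sum => i _; rewrite normrM.
have -> : 'D_(basis_vector i) (iter_deriv s f) X =
          iter_deriv s ('D_(basis_vector i) f) X.
  have := iter_deriv_catCons f s [::] (basis_vector i) sf.
  by rewrite cats0 iter_deriv_cat /= => ->.
have [C0 /(_ X s sk) HCi] := HC i.
apply: (le_trans (ler_wpM2l (normr_ge0 _) HCi)).
rewrite /P big_cons; set Q := \prod_(T <- _) _.
have -> :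
  `|coordinate i T| * (C i * (M X * Num.sqrt (g X (basis_vector i))) * Q)
  = C i * M X * Q * (`|coordinate i T| * Num.sqrt (g X (basis_vector i))).
  by ring.
have -> : C i * M X * (Num.sqrt (g X T) * Q) = C i * M X * Q * Num.sqrt (g X T).
  by ring.
apply: ler_wpM2l; last exact: coord_le.
by rewrite mulr_ge0 ?prodr_ge0 // mulr_ge0 // ltW.
Qed.

(** Occurrences are counted on the indices and the permutation is then mapped through
    [basis_vector], so no injectivity of [basis_vector] is involved. *)
Lemma perm_mi_dirs (b : seq ('I_n + 'I_n)) :
  perm_eq (map basis_vector b)
    (mi_dirs e_x [ffun j => count_mem (inl j) b]
     ++ mi_dirs e_xi [ffun j => count_mem (inr j) b]).
Proof.
pose dirs (h : 'I_n -> 'I_n + 'I_n) :=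
  flatten [seq nseq (count_mem (h j) b) (h j) | j <- enum 'I_n].
have dirsE (h : 'I_n -> 'I_n + 'I_n) (e : 'I_n -> phase) :
    (forall j, basis_vector (h j) = e j) ->
    mi_dirs e [ffun j => count_mem (h j) b] = map basis_vector (dirs h).
  move=> he; rewrite /mi_dirs /dirs map_flatten -map_comp; congr flatten.
  by apply: eq_map => j /=; rewrite map_nseq he ffunE.
rewrite (dirsE inl) // (dirsE inr) // -map_cat; apply: perm_map.
have count_dirs (h : 'I_n -> 'I_n + 'I_n) (i : 'I_n + 'I_n) :
    count_mem i (dirs h) = (\sum_(j < n) (h j == i) * count_mem (h j) b)%N.
  rewrite count_flatten sumnE 2!big_map big_enum /=.
  by apply: eq_bigr => j _; rewrite count_nseq.
apply/allP => -[] j _ /=; apply/eqP; rewrite count_cat !count_dirs.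
  rewrite (bigD1 j) //= eqxx mul1n big1 ?addn0 => [|l lj].
    by rewrite big1 ?addn0.
  by rewrite -[inl l == inl j]/(l == j) (negbTE lj).
rewrite big1 // add0n (bigD1 j) //= eqxx mul1n big1 ?addn0 // => l lj.
by rewrite -[inr l == inr j]/(l == j) (negbTE lj).
Qed.

Lemma prod_mi_dirs (e : 'I_n -> phase) (alpha : multi_index) (F : phase -> R)
    (c : R) : (forall j, F (e j) = c) ->
  \prod_(T <- mi_dirs e alpha) F T = c ^+ mi_size alpha.
Proof.
move=> Fe; rewrite big_flatten big_map big_enum /= /mi_size -prodrXr.
by apply: eq_bigr => j _; rewrite big_nseq Fe iter_mulr_1.
Qed.

End IteratedDerivatives.

(** * The symplectic dual metric and the uncertainty parameter *)

Section Uncertainty.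
Context {R : realType} {n : nat}.
Local Notation phase := ('rV[R]_n * 'rV[R]_n)%type.
Implicit Types (x y z : 'rV[R]_n) (T X Y : phase).

Lemma dot_sqr_ge0 x : 0 <= dot x x.
Proof. by apply: sumr_ge0 => i _; rewrite -expr2 sqr_ge0. Qed.

Lemma dot_sqr_gt0 x : x != 0 -> 0 < dot x x.
Proof.
move=> x0; rewrite lt_neqAle dot_sqr_ge0 andbT eq_sym.
apply: contra x0 => /eqP /psumr_eq0P x0; apply/eqP/rowP => i.
rewrite mxE; apply/eqP; rewrite -sqrf_eq0 expr2; apply/eqP.
by apply: x0 => // j _; rewrite -expr2 sqr_ge0.
Qed.

Lemma dotC x y : dot x y = dot y x.
Proof. by apply: eq_bigr => i _; rewrite mulrC. Qed.

Lemma dot_lincomb_sqr (a b : R) x y :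
  dot (a *: x + b *: y) (a *: x + b *: y) =
  a ^+ 2 * dot x x + 2 * (a * b) * dot x y + b ^+ 2 * dot y y.
Proof.
rewrite /dot !mulr_sumr -!big_split /=; apply: eq_bigr => i _.
by rewrite !mxE; ring.
Qed.

Lemma dotZr (a : R) x y : dot x (a *: y) = a * dot x y.
Proof.
by rewrite /dot mulr_sumr; apply: eq_bigr => i _; rewrite mxE; ring.
Qed.

Lemma sqr_enorm x : enorm x ^+ 2 = dot x x.
Proof. by rewrite sqr_sqrtr // dot_sqr_ge0. Qed.

Lemma dot_pair_gt0 (a b : R) T : 0 < a -> 0 < b -> T != 0 ->
  0 < a * dot T.1 T.1 + b * dot T.2 T.2.
Proof.
move=> a0 b0; case: T => x y /=; rewrite xpair_eqE negb_and => /orP[x0|y0].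
  by rewrite ltr_pwDl ?mulr_gt0 ?dot_sqr_gt0 // mulr_ge0 ?dot_sqr_ge0 // ltW.
by rewrite ltr_wpDl ?mulr_gt0 ?dot_sqr_gt0 // mulr_ge0 ?dot_sqr_ge0 // ltW.
Qed.

(* The polynomial [r |-> g(Y - r Z)], with [Z = (- a T.2, b T.1)] the vector
   representing [symplectic ^~ T] for [g], is nonnegative at its minimum. *)
Lemma symplectic_Cauchy (a b : R) T Y : 0 < a -> 0 < b -> T != 0 ->
  symplectic Y T ^+ 2 <=
  (b * dot T.1 T.1 + a * dot T.2 T.2) * (dot Y.1 Y.1 / a + dot Y.2 Y.2 / b).
Proof.
move=> a0 b0 T0; rewrite /symplectic.
have := dot_pair_gt0 b a T b0 a0 T0.
set N := b * _ + _ => N0; set s := dot T.1 Y.2 - _.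
(* Here [N = g(Z)] and the minimum is at [r = s / N]; scaling by [N] gives the vector [N Y - s Z],
   whose two components enter [h1] and [h2]. *)
have h1 : 0 <= dot (N *: Y.1 + (s * a) *: T.2) (N *: Y.1 + (s * a) *: T.2) / a.
  by rewrite divr_ge0 ?dot_sqr_ge0 // ltW.
have h2 :
    0 <= dot (N *: Y.2 + (- s * b) *: T.1) (N *: Y.2 + (- s * b) *: T.1) / b.
  by rewrite divr_ge0 ?dot_sqr_ge0 // ltW.
rewrite -subr_ge0 -(pmulr_rge0 _ N0).
suff -> : N * (N * (dot Y.1 Y.1 / a + dot Y.2 Y.2 / b) - s ^+ 2) =
  dot (N *: Y.1 + (s * a) *: T.2) (N *: Y.1 + (s * a) *: T.2) / a +
  dot (N *: Y.2 + (- s * b) *: T.1) (N *: Y.2 + (- s * b) *: T.1) / b.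
  by rewrite addr_ge0.
rewrite !dot_lincomb_sqr (dotC Y.2 T.1).
(* Eliminating [dot T.1 Y.2] and [dot T.1 T.1] in favour of [s] and [N] leaves a rational
   identity. *)
have -> : dot T.1 Y.2 = s + dot Y.1 T.2 by rewrite /s subrK.
have bt : b * dot T.1 T.1 = N - a * dot T.2 T.2 by rewrite /N addrK.
have -> : dot T.1 T.1 = (N - a * dot T.2 T.2) / b.
  by rewrite -bt mulrC mulKf // gt_eqF.
by field; rewrite !gt_eqF.
Qed.

(** [symplectic_Cauchy] gives the upper bound, and it is attained at [Y = (- a T.2, b T.1)], where
    [symplectic Y T] and [g X Y] coincide. *)
Lemma dual_metricE (g : phase -> phase -> R) (a b : R) X T :
  0 < a -> 0 < b ->
  (forall Y, g X Y = dot Y.1 Y.1 / a + dot Y.2 Y.2 / b) -> T != 0 ->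
  dual_metric g X T = b * dot T.1 T.1 + a * dot T.2 T.2.
Proof.
move=> a0 b0 gE T0.
have N0 := dot_pair_gt0 b a T b0 a0 T0.
have gY0 Y : Y != 0 -> 0 < g X Y.
  move=> Y0; rewrite gE mulrC [X in _ + X]mulrC.
  by apply: dot_pair_gt0; rewrite ?invr_gt0.
have ub : ubound
    [set symplectic Y T ^+ 2 / g X Y | Y in [set Y : phase | Y != 0]]
    (b * dot T.1 T.1 + a * dot T.2 T.2).
  move=> _ [Y /= Y0 <-]; rewrite ler_pdivrMr ?gY0 // gE.
  exact: symplectic_Cauchy.
pose Y : phase := (- a *: T.2, b *: T.1).
have gYE : g X Y = b * dot T.1 T.1 + a * dot T.2 T.2.
  rewrite gE /= !dotZr ![dot (_ *: _) _]dotC !dotZr.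
  by field; rewrite !gt_eqF.
have sYE : symplectic Y T = b * dot T.1 T.1 + a * dot T.2 T.2.
  by rewrite /symplectic /= dotZr (dotC _ T.2) dotZr; ring.
have Y0 : Y != 0.
  apply/negP => /eqP Y0.
  have : g X Y = 0.
    by rewrite Y0 gE /= /dot !big1 ?mul0r ?addr0 // => i _; rewrite mxE mul0r.
  by rewrite gYE => E; move: N0; rewrite E ltxx.
have memY : [set symplectic Y T ^+ 2 / g X Y | Y in [set Y : phase | Y != 0]]
    (b * dot T.1 T.1 + a * dot T.2 T.2).
  by exists Y => //; rewrite sYE gYE expr2 mulfK // gt_eqF.
apply/eqP; rewrite eq_le; apply/andP; split.
  by apply: ge_sup => //; exists (b * dot T.1 T.1 + a * dot T.2 T.2).
by apply: ub_le_sup => //; exists (b * dot T.1 T.1 + a * dot T.2 T.2).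
Qed.

(** The dual metric is [a * b] times [g], so the ratio does not depend on [T] and the infimum is
    over a single value; positive dimension supplies a nonzero [T]. *)
Lemma uncertaintyE (g : phase -> phase -> R) (a b : R) X : (0 < n)%N ->
  0 < a -> 0 < b ->
  (forall Y, g X Y = dot Y.1 Y.1 / a + dot Y.2 Y.2 / b) ->
  uncertainty g X = Num.sqrt (a * b).
Proof.
move=> n0 a0 b0 gE.
have ratioE T : T != 0 ->
    Num.sqrt (dual_metric g X T / g X T) = Num.sqrt (a * b).
  move=> T0; rewrite (dual_metricE g a b) //; congr Num.sqrt.
  have -> : b * dot T.1 T.1 + a * dot T.2 T.2 = a * b * g X T.
    by rewrite gE; field; rewrite !gt_eqF.
  rewrite mulfK // gE mulrC [X in _ + X]mulrC.
  by rewrite gt_eqF //; apply: dot_pair_gt0; rewrite ?invr_gt0.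
rewrite /uncertainty; set S := [set _ | T in _].
suff -> : S = [set Num.sqrt (a * b)] by rewrite inf1.
apply/seteqP; split => [_ [T /= T0 <-]|_ ->]; first exact: ratioE.
have T0 : e_x (Ordinal n0) != 0 :> phase.
  apply/negP => /eqP /(congr1 (fun T : phase => T.1 0 (Ordinal n0))) /eqP.
  by rewrite /= !mxE !eqxx oner_eq0.
by exists (e_x (Ordinal n0)) => //; exact: ratioE.
Qed.

End Uncertainty.

(** * Comparison of the two families of symbol estimates *)

Section Symbols.
Context {R : realType} {n : nat}.
Local Notation phase := ('rV[R]_n * 'rV[R]_n)%type.

Lemma normRe_le_normc (z : R[i]) : `|complex.Re z| <= normc z.
Proof.
by case: z => a b /=; rewrite -sqrtr_sqr ler_wsqrtr // lerDl sqr_ge0.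
Qed.

Lemma normIm_le_normc (z : R[i]) : `|complex.Im z| <= normc z.
Proof.
by case: z => a b /=; rewrite -sqrtr_sqr ler_wsqrtr // lerDr sqr_ge0.
Qed.

Lemma normc_le_ReIm (z : R[i]) :
  normc z <= `|complex.Re z| + `|complex.Im z|.
Proof.
case: z => a b /=.
rewrite -[leRHS]ger0_norm ?addr_ge0 // -sqrtr_sqr ler_wsqrtr //
  sqrrD !real_normK ?num_real //.
by rewrite addrAC lerDl mulrn_wge0 // mulr_ge0.
Qed.

Lemma sqr_entry_le_dot (x : 'rV[R]_n) j : x 0 j ^+ 2 <= dot x x.
Proof.
rewrite /dot (bigD1 j) //= -expr2 lerDl sumr_ge0 // => i _.
by rewrite -expr2 sqr_ge0.
Qed.

Lemma dot_delta (j : 'I_n) : dot (delta_mx 0 j) (delta_mx 0 j) = 1 :> R.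
Proof.
rewrite /dot (bigD1 j) //= !mxE !eqxx mulr1 big1 ?addr0 // => i ij.
by rewrite !mxE eqxx (negbTE ij) mulr0.
Qed.

Lemma dot00 : dot (0 : 'rV[R]_n) 0 = 0.
Proof. by rewrite /dot big1 // => i _; rewrite mxE mul0r. Qed.

Context (gamma kappa : R) (gamma_gt0 : 0 < gamma) (kappa_gt0 : 0 < kappa)
  (A V : 'rV[R]_n -> R) (q : R).
Local Notation w := (weight q A V).
Local Notation g := (metric gamma kappa q A V).
Hypothesis w_gt0 : forall X, 0 < w X.

Lemma metricE X T : g X T =
  dot T.1 T.1 / w X `^ (1 / kappa) + dot T.2 T.2 / w X `^ (1 / gamma).
Proof. by rewrite /metric !sqr_enorm. Qed.

(** The uncertainty is [w] to the power [(kappa + gamma) / (2 * kappa * gamma)], which the outer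
    exponent cancels. *)
Lemma uncertainty_powR (m : R) X : (0 < n)%N ->
  uncertainty g X `^ (m * (2 * kappa * gamma / (kappa + gamma))) = w X `^ m.
Proof.
move=> n_gt0; have w0 := w_gt0 X.
rewrite (uncertaintyE g (w X `^ (1 / kappa)) (w X `^ (1 / gamma))) ?powR_gt0 //;
  last exact: metricE.
rewrite -powRD; last by rewrite (gt_eqF w0) implybT.
rewrite -powR12_sqrt ?powR_ge0 // -!powRrM; congr (_ `^ _).
by field; rewrite !gt_eqF ?addr_gt0.
Qed.

Lemma sqrt_metric_e_x X j :
  Num.sqrt (g X (e_x j)) = w X `^ (- (1 / (2 * kappa))).
Proof.
rewrite metricE /= dot_delta dot00 mul0r addr0 !div1r -powRN.
rewrite -powR12_sqrt ?powR_ge0 // -powRrM; congr (_ `^ _).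
by field; rewrite gt_eqF.
Qed.

Lemma sqrt_metric_e_xi X j :
  Num.sqrt (g X (e_xi j)) = w X `^ (- (1 / (2 * gamma))).
Proof.
rewrite metricE /= dot_delta dot00 mul0r add0r !div1r -powRN.
rewrite -powR12_sqrt ?powR_ge0 // -powRrM; congr (_ `^ _).
by field; rewrite gt_eqF.
Qed.

(** After squaring, the left side is one squared entry of one of the two nonnegative summands of
    [g X T]. *)
Lemma coordinate_le_metric i X T :
  `|coordinate i T| * Num.sqrt (g X (basis_vector i)) <= Num.sqrt (g X T).
Proof.
rewrite -sqrtr_sqr -sqrtrM ?sqr_ge0 // ler_wsqrtr //.
have pos (x : 'rV[R]_n) (r : R) : 0 <= dot x x / w X `^ r.
  by rewrite divr_ge0 ?dot_sqr_ge0 ?powR_ge0.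
case: i => j; rewrite !metricE /= dot_delta dot00 mul0r ?addr0 ?add0r mulrA mulr1.
  by rewrite ler_wpDr // ler_wpM2r ?invr_ge0 ?powR_ge0 ?sqr_entry_le_dot.
by rewrite ler_wpDl // ler_wpM2r ?invr_ge0 ?powR_ge0 ?sqr_entry_le_dot.
Qed.

(** This puts the bound defining [Sigma_class] in the shape of the one defining [symbol_class],
    along coordinate directions. *)
Lemma weight_mi_dirs (m : R) (alpha beta : multi_index) X :
  w X `^ (m - (mi_size beta)%:R / (2 * kappa)
            - (mi_size alpha)%:R / (2 * gamma)) =
  w X `^ m *
    \prod_(T <- mi_dirs e_x beta ++ mi_dirs e_xi alpha) Num.sqrt (g X T).
Proof.
rewrite big_cat /=.
rewrite (prod_mi_dirs _ _ _ _ (sqrt_metric_e_x X)).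
rewrite (prod_mi_dirs _ _ _ _ (sqrt_metric_e_xi X)).
rewrite -!powR_mulrn ?powR_ge0 // -!powRrM.
rewrite -!powRD ?(gt_eqF (w_gt0 X)) ?implybT //.
by congr (_ `^ _); ring.
Qed.

Lemma symbol_class_Sigma_class (m : R) (a : phase -> R[i]) :
  symbol_class (fun X => w X `^ m) g a -> Sigma_class gamma kappa q A V m a.
Proof.
move=> [sa ba]; split=> // alpha beta.
pose s := mi_dirs (e_x (R := R)) beta ++ mi_dirs e_xi alpha.
have [C _ HC] := ba (size s); exists C => X.
rewrite weight_mi_dirs mulrA.
have := HC X (in_tuple s).
by rewrite -(big_tuple _ _ _ xpredT (fun T => Num.sqrt (g X T))).
Qed.

Lemma Sigma_class_symbol_class (m : R) (a : phase -> R[i]) :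
  Sigma_class gamma kappa q A V m a -> symbol_class (fun X => w X `^ m) g a.
Proof.
move=> [[sRe sIm] ba]; split=> // k.
(* Stated for an abstract [part], so that the real-valued [iter_deriv_bound] serves both the real
   and the imaginary part. *)
have part_bound (part : R[i] -> R) :
    (forall z, `|part z| <= normc z) -> smooth (fun X => part (a X)) ->
    (forall s X, part (citer_deriv s a X) =
                 iter_deriv s (fun Y => part (a Y)) X) ->
    exists2 C : R, 0 < C & forall X s, size s = k ->
    `|iter_deriv s (fun Y => part (a Y)) X| <= C * w X `^ m
       * \prod_(T <- s) Num.sqrt (g X T).
  move=> part_le sp partE; apply: iter_deriv_bound => //.
  - exact: coordinate_le_metric.
  - by move=> X; exact: powR_ge0.
  (* The multi-indices count how often each direction occurs in [b]: [inr] for the frequency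
     variables, [inl] for the space variables. *)
  move=> b; have [C HC] := ba [ffun j => count_mem (inr j) b]
                              [ffun j => count_mem (inl j) b].
  exists C => X; rewrite (iter_deriv_perm _ _ _ sp (perm_mi_dirs b)).
  rewrite -partE; apply: (le_trans (part_le _)); apply: (le_trans (HC X)).
  rewrite weight_mi_dirs mulrA.
  by rewrite -(perm_big _ (perm_mi_dirs b)) /= big_map.
have [C1 C10 H1] := part_bound _ normRe_le_normc sRe (fun _ _ => erefl).
have [C2 C20 H2] := part_bound _ normIm_le_normc sIm (fun _ _ => erefl).
exists (C1 + C2); first exact: addr_gt0.
move=> X T; rewrite -(big_tuple _ _ T xpredT (fun S => Num.sqrt (g X S))).
apply: (le_trans (normc_le_ReIm _)); rewrite !mulrDl.
by apply: lerD; [apply: H1|apply: H2]; rewrite size_tuple.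
Qed.

End Symbols.

Theorem proposition4p2 (R : realType) (n : nat) (n_gt0 : (0 < n)%N)
    (gamma kappa : R) (gamma_gt0 : 0 < gamma) (kappa_gt0 : 0 < kappa)
    (A V : 'rV[R]_n -> R)
    (hA : tau_function gamma A) (hV : tau_function kappa V)
    (q : R) (q_gt0 : 0 < q)
    (hq : forall x xi : 'rV[R]_n, 1 <= q + V x + A xi)
    (m : R) :
  let g := metric gamma kappa q A V in
  Sigma_class gamma kappa q A V m =
  symbol_class
    (fun X => uncertainty g X `^ (m * (2 * kappa * gamma / (kappa + gamma)))) g.
Proof.
move=> g.
have w_gt0 X : 0 < weight q A V X by exact: lt_le_trans (hq X.1 X.2).
have -> :
  (fun X => uncertainty g X `^ (m * (2 * kappa * gamma / (kappa + gamma)))) = (fun X => weight q A V X `^ m).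
  by apply/funext => X; exact: uncertainty_powR.
apply/seteqP; split => a.
- exact: Sigma_class_symbol_class.
- exact: symbol_class_Sigma_class.
Qed.
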